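(* There is a randomized algorithm that, given (oracle access to) a graph $G$ on $n$ vertices with maximum degree $\Delta$, always outputs a proper $(\Delta+1)$-coloring of $G$ and uses $O(n^{2}\log n/\Delta)$ adjacency queries in expectation.
   Context: A proper $k$-coloring of a graph $G=(V,E)$ is a map $c:V\to\{1,\dots,k\}$ with $c(u)\neq c(v)$ for every edge $\{u,v\}\in E$. Query model: the graph $G=(V,E)$, $|V|=n$, is accessible only through an oracle answering (i) adjacency queries: given $u,v\in V$, whether $\{u,v\}\in E$; (ii) degree queries: given $v$, its degree $d(v)$; (iii) neighborhood queries: given $v$ and an integer $j$, the $j$-th neighbor of $v$ in an arbitrary but fixed ordering (or a special symbol $\perp$ if $v$ has fewer than $j$ neighbors). The cost of an algorithm is the number of oracle queries it makes; the expectation is over the algorithm's internal randomness. *)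

(* Defs.v *)
From HB Require Import structures.
From mathcomp Require Import all_boot all_order all_algebra.
From mathcomp Require Import reals exp.
Set Implicit Arguments.
Unset Strict Implicit.
Unset Printing Implicit Defensive.
Import Order.TTheory GRing.Theory Num.Theory.
Local Open Scope ring_scope.

Record graph (n : nat) := Graph {
  adj : rel 'I_n;
  adj_sym : symmetric adj;
  adj_irrefl : irreflexive adj
}.

Definition degree n (G : graph n) (v : 'I_n) : nat := #|[set u | adj G v u]|.

Definition max_degree n (G : graph n) : nat := (\max_(v < n) degree G v)%N.

Definition proper_coloring n k (G : graph n) (c : {ffun 'I_n -> 'I_k}) : bool :=
  [forall u, forall v, adj G u v ==> (c u != c v)].

Record nbr_order n (G : graph n) := NbrOrder {
  nbrs : 'I_n -> seq 'I_n;
  nbrs_perm : forall v, perm_eq (nbrs v) (enum [set u | adj G v u])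
}.

Inductive query (n : nat) :=
  | Adjacency of 'I_n & 'I_n
  | Degree of 'I_n
  | Neighbor of 'I_n & nat.

Definition is_adjacency n (q : query n) : bool :=
  if q is Adjacency _ _ then true else false.

Definition response n (q : query n) : Type :=
  match q with
  | Adjacency _ _ => bool
  | Degree _ => nat
  | Neighbor _ _ => option 'I_n
  end.

(* Neighbours are counted from 1; [None] plays the role of the symbol "bottom"
   (also returned for the meaningless index 0). *)
Definition oracle n (G : graph n) (o : nbr_order G) (q : query n) : response q :=
  match q with
  | Adjacency u v => adj G u v
  | Degree v => degree G v
  | Neighbor v j => if j is j'.+1 then onth (nbrs o v) j' else None
  end.

(* A randomized query algorithm on the vertex set 'I_n with output in A.  It
   sees the graph only through the responses to its queries, on which (together
   with its earlier random draws) its next step may depend.  [Sample m k] draws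
   i uniformly from 'I_m.+1, independently of the past, and goes on with [k i].
   The type is inductive, so that every run halts with an output. *)
Inductive ralg (n : nat) (A : Type) : Type :=
  | Return of A
  | Ask (q : query n) of (response q -> ralg n A)
  | Sample (m : nat) of ('I_m.+1 -> ralg n A).

(* [always o P p]: whatever the random draws, the run of p on the graph ends
   with a transcript t (the sequence of all queries made) and an output a such
   that P t a. *)
Fixpoint always n (G : graph n) (o : nbr_order G) A
    (P : seq (query n) -> A -> Prop) (p : ralg n A) : Prop :=
  match p with
  | Return a => P [::] a
  | Ask q k => always o (fun t => P (q :: t)) (k (oracle o q))
  | Sample m k => forall i, always o P (k i)
  end.

(* Expectation, over the random draws, of f applied to the transcript and the
   output. *)
Fixpoint expect (R : realType) n (G : graph n) (o : nbr_order G) A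
    (f : seq (query n) -> A -> R) (p : ralg n A) : R :=
  match p with
  | Return a => f [::] a
  | Ask q k => expect o (fun t => f (q :: t)) (k (oracle o q))
  | Sample m k => (\sum_(i < m.+1) expect o f (k i)) / m.+1%:R
  end.

Definition expected_cost (R : realType) n (G : graph n) (o : nbr_order G) A
    (p : ralg n A) : R :=
  expect o (fun t _ => (size t)%:R) p.

(* Main.v *)
(** Colour the vertices in a uniformly random order; for the vertex at hand try
    the colours in a uniformly random order, testing a colour by querying all
    pairs formed with a vertex already bearing it.

    If [a] colours are available then, drawing without replacement, the expected
    number of queries spent on the vertex is at most (number of coloured
    vertices) / [a], hence at most [n / a].  A vertex with
    [m = Delta + 1 - #(coloured neighbours)] has at least [m] available colours, and
    the potential [n * \sum_v H_m / m] over the uncoloured vertices [v]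
    ([H_m] the harmonic number) dominates the expected remaining cost.  It starts
    at [n^2 * H_(Delta+1) / (Delta+1)]. *)
Require Import Defs.
From HB Require Import structures.
From mathcomp Require Import all_boot all_order all_algebra.
From mathcomp Require Import reals exp.
From mathcomp Require Import lra zify.
Set Implicit Arguments.
Unset Strict Implicit.
Unset Printing Implicit Defensive.
Import Order.TTheory GRing.Theory Num.Theory.
Local Open Scope ring_scope.

(** * Expectation and sure properties of query algorithms *)

(** A draw is a uniform average, so a constant passes through it. Both [f] and [g] vary in the
    induction because [expect] pushes every query into its functional. *)
Lemma expectS (R : realType) n (G : graph n) (o : nbr_order G) A
    (f g : seq (query n) -> A -> R) (p : ralg n A) :
  (forall t a, g t a = 1 + f t a) -> expect o g p = 1 + expect o f p.
Proof.
elim: p f g => [a|q k IH|m k IH] f g fg /=; first exact: fg.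
- by apply: (IH (oracle o q) (fun t => f (q :: t))) => t a; exact: fg.
- rewrite (eq_bigr (fun i => 1 + expect o f (k i))); last first.
    by move=> i _; exact: (IH i f g).
  rewrite big_split /= sumr_const card_ord mulrDl divff //.
  by rewrite pnatr_eq0.
Qed.

Lemma expected_cost_ask (R : realType) n (G : graph n) (o : nbr_order G) A
    (q : query n) (k : response q -> ralg n A) :
  expected_cost R o (Ask k) = 1 + expected_cost R o (k (oracle o q)).
Proof.
apply: (@expectS R n G o A (fun t _ => (size t)%:R) (fun t _ => (size t).+1%:R)).
by move=> t _; rewrite -natr1 addrC.
Qed.

Lemma always_imp n (G : graph n) (o : nbr_order G) A
    (P Q : seq (query n) -> A -> Prop) (p : ralg n A) :
  (forall t a, P t a -> Q t a) -> always o P p -> always o Q p.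
Proof.
elim: p P Q => [a|q k IH|m k IH] P Q PQ /=; first exact: PQ.
- by apply: (IH (oracle o q) (fun t => P (q :: t))) => t a; exact: PQ.
- by move=> H i; apply: (IH i P Q) => //.
Qed.

(** * The algorithm, in continuation-passing style *)

Section Algorithm.
Variables (n : nat) (A : Type).

(** [Sample] needs a nonempty range; [p0] is the default for empty [X]. *)
Definition draw (T : finType) (X : {set T}) (p0 : ralg n A)
    (k : T -> ralg n A) : ralg n A :=
  if enum X is x :: s then Sample (fun i : 'I_(size s).+1 => k (nth x (x :: s) i))
  else p0.

(** There is no early exit after a hit, so the number of queries is exactly [size us]. *)
Fixpoint has_neighbor (v : 'I_n) (us : seq 'I_n) (b : bool)
    (k : bool -> ralg n A) : ralg n A :=
  if us is u :: us' then
    Ask (fun b' : response (Adjacency v u) => has_neighbor v us' (b || b') k)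
  else k b.

Fixpoint find_color (K : finType) (cls : K -> {set 'I_n}) (v : 'I_n)
    (p0 : ralg n A) (k : K -> ralg n A) (fuel : nat) (S : {set K}) : ralg n A :=
  if fuel is fuel'.+1 then
    draw S p0 (fun a => has_neighbor v (enum (cls a)) false
      (fun b => if b then find_color cls v p0 k fuel' (S :\ a) else k a))
  else p0.

End Algorithm.

(** [U] is the set of uncoloured vertices; values of [c] on [U] are placeholders. *)
Definition color_class n (K : finType) (U : {set 'I_n}) (c : {ffun 'I_n -> K})
  (a : K) : {set 'I_n} := [set u | (u \notin U) && (c u == a)].

Fixpoint color_vertices n (K : finType) (fuel : nat) (U : {set 'I_n})
    (c : {ffun 'I_n -> K}) : ralg n {ffun 'I_n -> K} :=
  if fuel is fuel'.+1 then
    draw U (Return n c) (fun v =>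
      find_color (color_class U c) v (Return n c)
        (fun a => color_vertices fuel' (U :\ v)
                    [ffun u => if u == v then a else c u])
        #|K| [set: K])
  else Return n c.

(** * Colouring a single vertex: soundness and expected cost *)

Section Draw.
Variables (n : nat) (G : graph n) (o : nbr_order G) (A : Type).

Lemma always_draw (T : finType) (X : {set T}) P p0 (k : T -> ralg n A) :
  X != set0 -> (forall x, x \in X -> always o P (k x)) -> always o P (draw X p0 k).
Proof.
rewrite /draw; case E: (enum X) => [|x s] X0 H.
  by case/set0Pn: X0 => x; rewrite -mem_enum E.
move=> /= i; apply: H; rewrite -mem_enum E.
exact: (@mem_nth _ x (x :: s) i).
Qed.

Lemma expected_cost_draw (R : realType) (T : finType) (X : {set T}) p0
    (k : T -> ralg n A) :
  X != set0 ->
  expected_cost R o (draw X p0 k)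
    = (\sum_(x in X) expected_cost R o (k x)) / #|X|%:R.
Proof.
rewrite /draw -[in RHS]big_enum /= cardE; case E: (enum X) => [|x s] X0.
  by case/set0Pn: X0 => x; rewrite -mem_enum E.
by rewrite [in RHS](big_nth x) big_mkord.
Qed.

(** Putting an adjacency query in front of the transcript leaves [all (@is_adjacency n)] unchanged
    up to computation, so a postcondition of this shape passes through the queries. *)
Lemma always_has_neighbor Q v us b (k : bool -> ralg n A) :
  always o (fun t a => all (@is_adjacency n) t /\ Q a)
    (k (b || has (adj G v) us)) ->
  always o (fun t a => all (@is_adjacency n) t /\ Q a) (has_neighbor v us b k).
Proof.
elim: us b => [|u us IH] b /=; first by rewrite orbF.
by rewrite orbA => /IH.
Qed.

Lemma expected_cost_has_neighbor (R : realType) v us b (k : bool -> ralg n A) :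
  expected_cost R o (has_neighbor v us b k)
    = (size us)%:R + expected_cost R o (k (b || has (adj G v) us)).
Proof.
elim: us b => [|u us IH] b /=; first by rewrite orbF add0r.
by rewrite expected_cost_ask /= IH orbA -natr1 [_ + 1]addrC addrA.
Qed.

Variables (K : finType) (cls : K -> {set 'I_n}) (v : 'I_n).

Definition available : {set K} :=
  [set a | [forall u in cls a, ~~ adj G v u]].

Lemma has_neighborE a : has (adj G v) (enum (cls a)) = (a \notin available).
Proof.
rewrite inE negb_forall; apply/hasP/existsP => -[u].
  by rewrite mem_enum => uc uv; exists u; rewrite uc uv.
by rewrite negb_imply negbK => /andP[uc uv]; exists u; rewrite ?mem_enum.
Qed.

Lemma always_find_color Q p0 (k : K -> ralg n A) fuel (S : {set K}) :
  #|S| = fuel -> available != set0 -> available \subset S ->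
  (forall a, a \in available ->
     always o (fun t a => all (@is_adjacency n) t /\ Q a) (k a)) ->
  always o (fun t a => all (@is_adjacency n) t /\ Q a)
    (find_color cls v p0 k fuel S).
Proof.
move=> cS av0 avS H; elim: fuel S cS avS => [|fuel IH] S cS avS /=.
  move/eqP: cS; rewrite cards_eq0 => /eqP S0.
  by move: avS av0; rewrite S0 subset0 => ->.
apply: always_draw => [|a aS].
  by rewrite -cards_eq0 cS.
apply: always_has_neighbor; rewrite has_neighborE /=.
have [/H //|aav] := boolP (a \in available).
apply: IH; first by move: cS; rewrite (cardsD1 a) aS => -[].
by rewrite subsetD1 avS.
Qed.

(* With [N S] the total size of the classes in [S] and [a] available colours,
   the unavailable draws [c] leave at most
   [\sum_c (N S - #|cls c|) / a <= (#|S| - a) * N S / a], so one draw preserves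
   the bound [N S / a]. *)
Lemma expected_cost_find_color (R : realType) p0 (k : K -> ralg n A) fuel
    (S : {set K}) (B : R) :
  #|S| = fuel -> available != set0 -> available \subset S ->
  (forall a, a \in available -> expected_cost R o (k a) <= B) ->
  expected_cost R o (find_color cls v p0 k fuel S)
    <= (\sum_(a in S) #|cls a|)%:R / #|available|%:R + B.
Proof.
move=> cS av0 avS H; elim: fuel S cS avS => [|fuel IH] S cS avS /=.
  move/eqP: cS; rewrite cards_eq0 => /eqP S0.
  by move: avS av0; rewrite S0 subset0 => ->.
have S0 : S != set0 by rewrite -cards_eq0 cS.
rewrite expected_cost_draw //.
have S_gt0 : 0 < #|S|%:R :> R by rewrite cS ltr0n.
have a_gt0 : 0 < #|available|%:R :> R by rewrite ltr0n card_gt0.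
rewrite ler_pdivrMr //.
set N := (\sum_(a in S) #|cls a|)%N; set a := #|available|%:R.
have bnd c : c \in S ->
    expected_cost R o (has_neighbor v (enum (cls c)) false
      (fun b => if b then find_color cls v p0 k fuel (S :\ c) else k c))
    <= #|cls c|%:R + (N%:R / a *+ (c \notin available) + B).
  move=> cIS; rewrite expected_cost_has_neighbor has_neighborE -cardE lerD2l /=.
  have [/H|cav] := boolP (c \in available); first by rewrite add0r.
  rewrite mulr1n; apply: le_trans (IH _ _ _) _.
  - by move: cS; rewrite (cardsD1 c) cIS => -[].
  - by rewrite subsetD1 avS.
  rewrite lerD2r ler_pM2r ?invr_gt0 // ler_nat.
  by rewrite /N [leqRHS](big_setD1 c) //= leq_addl.
apply: le_trans (ler_sum _ bnd) _.
rewrite !big_split /= -natr_sum -/N sumr_const -[B *+ _]mulr_natr.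
rewrite mulrDl addrA lerD2r.
have -> : \sum_(c in S) N%:R / a *+ (c \notin available)
          = N%:R / a * (#|S|%:R - a).
  rewrite sumrMnr -[LHS]mulr_natr; congr (_ * _).
  rewrite /a -natrB ?subset_leq_card //; congr (_%:R).
  by rewrite -cardsDS // -sum1_card big_mkcond [RHS]big_mkcond /=; apply: eq_bigr => c _;
     rewrite in_setD; do 2!case: (_ \in _).
(* The cost [N] of the tests cancels against [N / a * a]. *)
rewrite mulrBr divfK ?gt_eqF //; lra.
Qed.

End Draw.

(** * Harmonic numbers and the averages [H_m / m] *)

Section Harmonic.
Variable R : realType.

Definition harmonic_sum (m : nat) : R := \sum_(k < m) k.+1%:R^-1.

Definition avg_inv (m : nat) : R := harmonic_sum m / m%:R.

Lemma mulr_avg_inv m : m%:R * avg_inv m = harmonic_sum m.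
Proof.
case: m => [|m]; first by rewrite mul0r /harmonic_sum big_ord0.
by rewrite mulrC divfK // pnatr_eq0.
Qed.

(** For [d = m - 1] this is an equality, by [m h(m) = (m-1) h(m-1) + 1/m] with [h = avg_inv].
    Smaller [d] follow since [h] does not increase from [m - 1] to [m] when [m > 1]. *)
Lemma avg_inv_decrease m d : (d < m)%N ->
  m%:R^-1 + d%:R * (avg_inv m.-1 - avg_inv m) <= avg_inv m.
Proof.
case: m => // p; rewrite ltnS => dp /=.
have HS : p.+1%:R * avg_inv p.+1
          = p%:R * avg_inv p + p.+1%:R^-1.
  by rewrite !mulr_avg_inv /harmonic_sum big_ord_recr.
suff anti : d%:R * (avg_inv p - avg_inv p.+1)
            <= p%:R * (avg_inv p - avg_inv p.+1).
  by move: HS anti; rewrite -natr1; lra.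
(* Monotonicity fails at the start, as [avg_inv 0 = 0 < avg_inv 1]; but there [d = 0]. *)
case: p dp HS => [|p] dp HS; first by move: dp; rewrite leqn0 => /eqP ->.
apply: ler_wpM2r; last by rewrite ler_nat.
have H1 : 1 <= harmonic_sum p.+1.
  rewrite /harmonic_sum big_ord_recl invr1 lerDl.
  by apply: sumr_ge0 => i _; rewrite invr_ge0.
have le1 : p.+2%:R^-1 <= avg_inv p.+1.
  apply: (@le_trans _ _ (p.+1%:R^-1)).
    by rewrite lef_pV2 ?posrE ?ltr0n // ler_nat.
  by rewrite /avg_inv ler_peMl // invr_ge0.
rewrite subr_ge0 -(@ler_pM2l _ p.+2%:R) ?ltr0n // HS.
by rewrite -[in leRHS]natr1 mulrDl mul1r lerD2l.
Qed.

Lemma harmonic_sum_le_ln m : (0 < m)%N -> harmonic_sum m <= 1 + ln m%:R.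
Proof.
case: m => // m _; elim: m => [|m IH].
  by rewrite /harmonic_sum big_ord1 invr1 ln1 addr0.
rewrite /harmonic_sum big_ord_recr /= -/(harmonic_sum _).
have m1 : 0 < m.+1%:R :> R by rewrite ltr0n.
have m2 : 0 < m.+2%:R :> R by rewrite ltr0n.
(* With [ln (1 + x) <= x] at [x = - 1 / (m + 2)], this gives
   [1 / (m + 2) <= ln (m + 2) - ln (m + 1)], and the sum telescopes. *)
have E : 1 + - m.+2%:R^-1 = m.+1%:R / m.+2%:R :> R.
  by apply: (mulIf (lt0r_neq0 m2)); rewrite divfK ?lt0r_neq0 // mulrDl mulNr
    mulVf ?lt0r_neq0 // mul1r -[in LHS]natr1 addrK.
have : ln (1 + - m.+2%:R^-1) <= - m.+2%:R^-1 :> R.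
  by apply: le_ln1Dx; rewrite ltrN2 invf_lt1 // ltr1n.
rewrite E ln_div ?posrE //; move: IH.
by move: (harmonic_sum _) (ln _) (ln _) (_^-1) => a b c d; lra.
Qed.

End Harmonic.

(** * Colouring all vertices: invariant and potential *)

Section Correctness.
Variables (n : nat) (G : graph n) (o : nbr_order G) (K : finType).
Hypothesis deg_lt : (max_degree G < #|K|)%N.
Implicit Types (U : {set 'I_n}) (c : {ffun 'I_n -> K}).

Definition free_count U v : nat := #|K| - #|[set u | adj G v u] :\: U|.

(** The degree of [v] splits into coloured and uncoloured neighbours and is below [#|K|]. This
    supplies the hypothesis [d < m] of [avg_inv_decrease], and shows that [free_count] is
    positive. *)
Lemma free_count_gt U v :
  (#|[set u | adj G v u] :&: U| < free_count U v)%N.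
Proof.
rewrite /free_count; have := cardsID U [set u | adj G v u].
have : (#|[set u | adj G v u]| <= max_degree G)%N.
  exact: (@leq_bigmax _ (degree G) v).
move: deg_lt; rewrite /degree.
move: #|_ :&: _| #|_ :\: _| #|[set u | _]| (max_degree G) #|K| => a b d m k; lia.
Qed.

Lemma free_countD1 U v w : v \in U ->
  free_count (U :\ v) w = (free_count U w - adj G w v)%N.
Proof.
move=> vU; rewrite /free_count -subnDA; congr (_ - _)%N.
rewrite (cardsD1 v) !inE eqxx /= addnC; congr (#|pred_of_set _| + _)%N.
apply/setP => x; rewrite !inE; case: eqVneq => [->|] //=.
by rewrite vU.
Qed.

Lemma free_count_le_available U c v :
  (free_count U v <= #|available G (color_class U c) v|)%N.
Proof.
rewrite /free_count leq_subLR -(cardsC (available G (color_class U c) v)) addnC.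
rewrite leq_add2r; apply: leq_trans (leq_imset_card c _).
apply: subset_leq_card; apply/subsetP => a; rewrite !inE negb_forall.
move=> /existsP[u]; rewrite negb_imply negbK !inE.
by move=> /andP[/andP[uU /eqP <-] uv]; apply: imset_f; rewrite !inE uU.
Qed.

Lemma available_neq0 U c v : available G (color_class U c) v != set0.
Proof.
rewrite -card_gt0; apply: leq_trans (free_count_le_available U c v).
by apply: leq_ltn_trans (free_count_gt U v).
Qed.

Lemma sum_color_class U c : (\sum_a #|color_class U c a| <= n)%N.
Proof.
rewrite -[leqRHS]card_ord -sum1_card (partition_big c xpredT) //=.
apply: leq_sum => a _; rewrite sum1_card; apply: subset_leq_card.
by apply/subsetP => u; rewrite !inE => /andP[].
Qed.

Lemma always_color_vertices fuel U c :
  #|U| = fuel ->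
  (forall u w, u \notin U -> w \notin U -> adj G u w -> c u != c w) ->
  always o (fun t c => all (@is_adjacency n) t /\
                       forall u w, adj G u w -> c u != c w)
    (color_vertices fuel U c).
Proof.
elim: fuel U c => [|fuel IH] U c cU proper_c /=.
  split=> // u w; move/eqP: cU; rewrite cards_eq0 => /eqP U0.
  by apply: proper_c; rewrite U0 inE.
apply: always_draw => [|v vU]; first by rewrite -cards_eq0 cU.
apply: always_find_color; rewrite ?cardsT ?subsetT ?available_neq0 //.
move=> a; rewrite inE => /forallP av_a.
apply: IH => [|u w]; first by move: cU; rewrite (cardsD1 v) vU => -[].
(* Only edges at the newly coloured [v] are new to the invariant. *)
have av x : x \notin U -> adj G v x -> c x != a.
  move=> xU vx; have := av_a x; rewrite !inE xU /= vx.
  by rewrite implybF.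
rewrite !inE !negb_and !negbK !ffunE.
case: eqVneq => [->|_] /=; case: eqVneq => [->|_] //=.
- by rewrite (adj_irrefl G).
- by move=> _ wU vw; rewrite eq_sym av.
- by move=> uU _; rewrite (adj_sym G) => vu; rewrite av.
- exact: proper_c.
Qed.

Variable R : realType.
Local Notation h := (avg_inv R).

(** This is the account of a fixed [w], summed over all choices of the next vertex: choosing [w]
    itself costs [1 / m], choosing one of its [d] uncoloured neighbours turns [h m] into [h m.-1],
    and any other choice leaves [h m]. The rest is [avg_inv_decrease]. *)
Lemma potential_step U w : w \in U ->
  (free_count U w)%:R^-1 + \sum_(v in U :\ w) h (free_count (U :\ v) w)
    <= #|U|%:R * h (free_count U w).
Proof.
move=> wU; set m := free_count U w.
have -> : \sum_(v in U :\ w) h (free_count (U :\ v) w)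
    = \sum_(v in U :\ w) h m + \sum_(v in U :\ w) (h m.-1 - h m) *+ adj G w v.
  rewrite -big_split; apply: eq_bigr => v /setD1P[_ vU].
  rewrite free_countD1 // -/m /=; case: adj; last by rewrite mulr0n subn0 addr0.
  by rewrite mulr1n subn1 addrC subrK.
have -> : \sum_(v in U :\ w) (h m.-1 - h m) *+ adj G w v
    = #|[set u | adj G w u] :&: U|%:R * (h m.-1 - h m).
  rewrite sumrMnr -[LHS]mulr_natl; congr (_%:R * _).
  rewrite -sum1_card big_mkcond [RHS]big_mkcond; apply: eq_bigr => v _ /=.
  rewrite !inE; case: eqVneq => [->|_]; first by rewrite (adj_irrefl G).
  by case: adj; case: (v \in U).
rewrite sumr_const -[h m *+ _]mulr_natl (cardsD1 w U) wU natrD mulrDl mul1r.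
rewrite addrCA addrC lerD2r.
exact/avg_inv_decrease/free_count_gt.
Qed.

Lemma expected_cost_color_vertices fuel U c :
  #|U| = fuel ->
  expected_cost R o (color_vertices fuel U c)
    <= n%:R * \sum_(v in U) h (free_count U v).
Proof.
elim: fuel U c => [|fuel IH] U c cU /=.
  by move/eqP: cU; rewrite cards_eq0 => /eqP ->; rewrite big_set0 mulr0.
have U0 : U != set0 by rewrite -cards_eq0 cU.
have U_gt0 : 0 < #|U|%:R :> R by rewrite cU ltr0n.
rewrite expected_cost_draw // ler_pdivrMr //.
have bnd v : v \in U ->
    expected_cost R o (find_color (color_class U c) v (Return n c)
        (fun a => color_vertices fuel (U :\ v)
                    [ffun u => if u == v then a else c u]) #|K| [set: K])
    <= n%:R * ((free_count U v)%:R^-1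
               + \sum_(w in U :\ v) h (free_count (U :\ v) w)).
  move=> vU; apply: le_trans (expected_cost_find_color (B :=
    n%:R * \sum_(w in U :\ v) h (free_count (U :\ v) w)) _ _ _ _ _) _.
  - by rewrite cardsT.
  - exact: available_neq0.
  - exact: subsetT.
  (* The potential depends on [U] but not on the colours, so one bound [B] serves all [a]. *)
  - by move=> a _; apply: IH; move: cU; rewrite (cardsD1 v) vU => -[].
  rewrite mulrDr lerD2r; apply: ler_pM; rewrite ?ler0n ?invr_ge0 ?ler0n //.
    rewrite ler_nat; apply: leq_trans (sum_color_class U c).
    by apply: eq_leq; apply: eq_bigl => a; rewrite inE.
  have m_gt0 : (0 < free_count U v)%N by apply: leq_ltn_trans (free_count_gt U v).
  have le := free_count_le_available U c v.
  by rewrite lef_pV2 ?posrE ?ltr0n ?ler_nat // (leq_trans m_gt0 le).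
apply: le_trans (ler_sum _ bnd) _.
rewrite -mulr_sumr -mulrA; apply: ler_wpM2l; first exact: ler0n.
(* Exchanging the sums groups the terms by the vertex [w] whose potential is counted, to match
   [potential_step]. *)
rewrite big_split /= [X in _ + X](exchange_big_dep (mem U)) /=; last first.
  by move=> v w _ /setD1P[].
rewrite -big_split /= mulr_suml; apply: ler_sum => w wU.
rewrite [leRHS]mulrC; apply: le_trans (potential_step wU); rewrite lerD2l.
rewrite le_eqVlt; apply/orP; left; apply/eqP; apply: eq_bigl => v.
by rewrite !inE wU andbT eq_sym andbC.
Qed.

End Correctness.

(** * From the initial potential to the stated bound *)

Theorem theorem1 (R : realType) :
  exists (alg : forall n Delta : nat, ralg n {ffun 'I_n -> 'I_Delta.+1}) (C : R),
    0 < C /\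
    forall (n : nat) (G : graph n) (o : nbr_order G),
      let Delta := max_degree G in
      [/\ always o (fun _ c => proper_coloring G c) (alg n Delta),
          always o (fun t _ => all (@is_adjacency n) t) (alg n Delta) &
          (0 < Delta)%N ->
          expected_cost R o (alg n Delta)
            <= C * (n%:R ^+ 2 * ln n%:R / Delta%:R)].
Proof.
have ln2_gt0 : 0 < ln 2 :> R by apply: ln_gt0; rewrite ltr1n.
(* The constant comes from [1 + ln (Delta + 1) <= ((ln 2)^-1 + 1) * ln n], valid since
   [2 <= Delta + 1 <= n]. *)
exists (fun n Delta => color_vertices n setT [ffun=> ord0]), ((ln 2)^-1 + 1).
split; first by rewrite addr_gt0 ?invr_gt0.
move=> n G o Delta.
have deg_lt : (max_degree G < #|'I_Delta.+1|)%N by rewrite card_ord.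
have cT : #|[set: 'I_n]| = n by rewrite cardsT card_ord.
have sound : always o (fun t (c : {ffun 'I_n -> 'I_Delta.+1}) => all (@is_adjacency n) t /\
    forall u w, adj G u w -> c u != c w)
    (color_vertices n setT [ffun=> (ord0 : 'I_Delta.+1)]).
  (* All vertices start uncoloured, so the invariant holds vacuously. *)
  by apply: always_color_vertices => // u w; rewrite inE.
split.
- apply: always_imp sound => t c [_ proper_c].
  by apply/forallP => u; apply/forallP => w; apply/implyP; exact: proper_c.
- by apply: always_imp sound => t c [].
move=> Delta_gt0.
apply: le_trans (expected_cost_color_vertices o deg_lt R _ cT) _.
have Delta_lt : (Delta < n)%N.
  have n_gt0 : (0 < n)%N.
    case: n G o @Delta Delta_gt0 {deg_lt cT sound} => // G o.
    by rewrite /max_degree big_ord0.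
  apply: (@leq_ltn_trans n.-1); last by rewrite prednK.
  apply/bigmax_leqP => v _; rewrite /degree.
  have := cardsC1 v; rewrite card_ord => <-; apply: subset_leq_card.
  apply/subsetP => u; rewrite !inE; apply: contraTneq => ->.
  by rewrite (adj_irrefl G).
(* Initially no neighbour is coloured, so every free count is [Delta + 1]. *)
have -> : \sum_(v in [set: 'I_n]) avg_inv R (free_count G 'I_Delta.+1 setT v)
    = n%:R * avg_inv R Delta.+1.
  rewrite (eq_bigr (fun=> avg_inv R Delta.+1)).
    by rewrite sumr_const cT mulr_natl.
  by move=> v _; rewrite /free_count setDT cards0 subn0 card_ord.
rewrite expr2 -!mulrA.
do 2!(rewrite [leRHS]mulrCA; apply: ler_wpM2l; first exact: ler0n).
rewrite /avg_inv mulrA.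
have n_gt0 : (0 < n)%N by apply: leq_trans Delta_lt.
have ln2n : ln 2 <= ln n%:R :> R.
  by rewrite ler_ln ?posrE ?ltr0n // ler_nat (leq_trans _ Delta_lt).
apply: ler_pM; rewrite ?invr_ge0 ?ler0n //.
- by apply: sumr_ge0 => i _; rewrite invr_ge0.
- apply: le_trans (harmonic_sum_le_ln R (ltn0Sn _)) _.
  rewrite mulrDl mul1r; apply: lerD.
    by rewrite mulrC ler_pdivlMr // mul1r.
  by rewrite ler_ln ?posrE ?ltr0n // ler_nat.
- by rewrite lef_pV2 ?posrE ?ltr0n // ler_nat.
Qed.
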